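(* If $n=4$, then every embedding of $\mathcal{E}_2$ into $\mathbb{S}^n$ is congruent to $$\begin{pmatrix}v&x&w&0\\ x&0&0&0\\ w&0&0&y\\0&0&y&0\end{pmatrix}.$$ If $n=5$, then every embedding of $\mathcal{E}_2$ into $\mathbb{S}^n$ is congruent to one of $$\begin{pmatrix}v&x&w&0&0\\ x&0&0&0&0\\ w&0&0&y&0\\0&0&y&0&0\\0&0&0&0&x\end{pmatrix},\qquad\begin{pmatrix}v&x&w&0&0\\ x&0&0&0&0\\ w&0&0&y&0\\0&0&y&0&0\\0&0&0&0&y\end{pmatrix}.$$
   Context: $\mathbb{S}^n$ is the space of complex symmetric $n\times n$ matrices. For an invertible $U\in\mathbb{S}^n$, the product $X\bullet_U Y=\frac12(XU^{-1}Y+YU^{-1}X)$ makes $\mathbb{S}^n$ a unital Jordan algebra with unit $U$. An embedding of a unital Jordan algebra $\mathcal{A}$ into $\mathbb{S}^n$ is the image of an injective linear map $\mathcal{A}\to\mathbb{S}^n$ preserving products and units, where $\mathbb{S}^n$ carries $\bullet_U$ for some invertible $U\in\mathbb{S}^n$. Two subspaces $\mathcal{L},\mathcal{L}'\subseteq\mathbb{S}^n$ are congruent if $\mathcal{L}'=P\mathcal{L}P^\top$ for some $P\in\mathrm{GL}_n(\mathbb{C})$. $\mathcal{E}_2$ is the $4$-dimensional complex Jordan algebra with basis $X,Y,V,W$, unit $X+Y$, and commutative product given by $X^2=X$, $XY=0$, $XV=V$, $XW=\frac12W$, $Y^2=Y$, $YV=0$, $YW=\frac12W$, $V^2=0$,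 $VW=0$, $W^2=0$. A matrix whose entries are linear forms in the indeterminates $v,w,x,y$ denotes the linear space of all matrices obtained by substituting complex numbers for the indeterminates. *)

(* Defs.v *)
From HB Require Import structures.
From mathcomp Require Import all_boot all_order all_algebra.
From mathcomp Require Import sesquilinear complex ring.
From mathcomp Require Import classical_sets reals.

Set Implicit Arguments.
Unset Strict Implicit.
Unset Printing Implicit Defensive.

Import Order.TTheory GRing.Theory Num.Theory.
Local Open Scope ring_scope.
Local Open Scope classical_set_scope.

HB.mixin Record Lmodule_isUnitalJordan (K : numFieldType) A
    of GRing.Lmodule K A := {
  jmul : A -> A -> A;
  jone : A;
  jmulC : commutative jmul;
  jmulDl : left_distributive jmul +%R;
  jmulZl : forall (c : K) (a b : A), jmul (c *: a) b = c *: jmul a b;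
  jmul1 : left_id jone jmul;
  jmul_jordan : forall a b : A,
    jmul (jmul a b) (jmul a a) = jmul a (jmul b (jmul a a))
}.

#[short(type="unitalJordanType")]
HB.structure Definition UnitalJordan (K : numFieldType) :=
  { A of GRing.Lmodule K A & Lmodule_isUnitalJordan K A }.

Section SymmetricMatrices.
Variables (K : numFieldType) (n : nat).
Implicit Types (U X Y : 'M[K]_n) (L : set 'M[K]_n).

Definition sym_jmul U X Y : 'M[K]_n :=
  2^-1 *: (X *m invmx U *m Y + Y *m invmx U *m X).

(* Linear subspaces of 'M_n are given as sets of matrices. *)
Definition is_embedding (A : unitalJordanType K) L : Prop :=
  exists2 U : 'M[K]_n, U \is symmetricmx /\ U \in unitmx &
  exists f : {linear A -> 'M[K]_n},
    [/\ injective f,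
        forall a : A, f a \is symmetricmx,
        forall a b : A, f (jmul a b) = sym_jmul U (f a) (f b),
        f jone = U
      & L = range f].

Definition congruent (L L' : set 'M[K]_n) : Prop :=
  exists2 P : 'M[K]_n, P \in unitmx & L' = [set P *m M *m P^T | M in L].

Definition mx_of_rows (s : seq (seq K)) : 'M[K]_n :=
  \matrix_(i < n, j < n) nth 0 (nth [::] s i) j.

End SymmetricMatrices.

Arguments mx_of_rows {K} n s.

(* The algebra E_2: coordinates are taken in the basis X, Y, V, W. *)
Definition E2 (K : numFieldType) : Type := 'rV[K]_4.

HB.instance Definition _ (K : numFieldType) := GRing.Lmodule.on (E2 K).

Section E2.
Variable K : numFieldType.

Definition E2_X : E2 K := delta_mx 0 (inord 0).
Definition E2_Y : E2 K := delta_mx 0 (inord 1).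
Definition E2_V : E2 K := delta_mx 0 (inord 2).
Definition E2_W : E2 K := delta_mx 0 (inord 3).

(* Products of basis vectors, in the order X, Y, V, W. *)
Definition E2_table : seq (seq (E2 K)) :=
  [:: [:: E2_X;         0;            E2_V; 2^-1 *: E2_W];
      [:: 0;            E2_Y;         0;    2^-1 *: E2_W];
      [:: E2_V;         0;            0;    0           ];
      [:: 2^-1 *: E2_W; 2^-1 *: E2_W; 0;    0           ]].

Definition E2_mul (a b : E2 K) : E2 K :=
  \sum_(i < 4) \sum_(j < 4)
    (a 0 i * b 0 j) *: nth 0 (nth [::] E2_table i) j.

Definition E2_one : E2 K := E2_X + E2_Y.

Lemma E2_mulE (a b : E2 K) : E2_mul a b =
  (a 0 (inord 0) * b 0 (inord 0)) *: E2_X +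
  (a 0 (inord 1) * b 0 (inord 1)) *: E2_Y +
  (a 0 (inord 0) * b 0 (inord 2) + a 0 (inord 2) * b 0 (inord 0)) *: E2_V +
  (2^-1 * ((a 0 (inord 0) + a 0 (inord 1)) * b 0 (inord 3) +
           a 0 (inord 3) * (b 0 (inord 0) + b 0 (inord 1)))) *: E2_W.
Proof.
have l0 : (ord0 : 'I_4) = inord 0 by apply: val_inj; rewrite /= inordK.
have l1 : lift ord0 ord0 = inord 1 :> 'I_4.
  by apply: val_inj; rewrite /= inordK.
have l2 : lift ord0 (lift ord0 ord0) = inord 2 :> 'I_4.
  by apply: val_inj; rewrite /= inordK.
have l3 : lift ord0 (lift ord0 (lift ord0 ord0)) = inord 3 :> 'I_4.
  by apply: val_inj; rewrite /= inordK.
rewrite /E2_mul !big_ord_recl !big_ord0 /= l1 l2 l3 l0.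
by apply/rowP => k; rewrite !mxE; ring.
Qed.

Lemma E2_mulC : commutative E2_mul.
Proof. by move=> a b; rewrite !E2_mulE; apply/rowP => k; rewrite !mxE; ring. Qed.

Lemma E2_mulDl : left_distributive E2_mul +%R.
Proof. by move=> a b c; rewrite !E2_mulE; apply/rowP => k; rewrite !mxE; ring. Qed.

Lemma E2_mulZl (c : K) (a b : E2 K) : E2_mul (c *: a) b = c *: E2_mul a b.
Proof. by rewrite !E2_mulE; apply/rowP => k; rewrite !mxE; ring. Qed.

Let E2_coordE : forall i j : nat, (i < 4)%N -> (j < 4)%N ->
  (inord i == inord j :> 'I_4) = (i == j).
Proof. by move=> i j li lj; rewrite -val_eqE /= !inordK. Qed.

Lemma E2_ext (a b : E2 K) :
  a 0 (inord 0) = b 0 (inord 0) -> a 0 (inord 1) = b 0 (inord 1) ->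
  a 0 (inord 2) = b 0 (inord 2) -> a 0 (inord 3) = b 0 (inord 3) -> a = b.
Proof.
move=> h0 h1 h2 h3; apply/rowP => k.
by rewrite -(inord_val k); case: k => -[|[|[|[|]]]].
Qed.

Lemma E2_mul1 : left_id E2_one E2_mul.
Proof.
move=> a; rewrite E2_mulE /E2_one.
by apply: E2_ext; rewrite !mxE !E2_coordE //=; field.
Qed.

Lemma E2_mul_jordan (a b : E2 K) :
  E2_mul (E2_mul a b) (E2_mul a a) = E2_mul a (E2_mul b (E2_mul a a)).
Proof.
by rewrite !E2_mulE; apply: E2_ext; rewrite !mxE !E2_coordE //=; field.
Qed.

HB.instance Definition _ := Lmodule_isUnitalJordan.Build K (E2 K)
  E2_mulC E2_mulDl E2_mulZl E2_mul1 E2_mul_jordan.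

End E2.

(* Main.v *)
Require Import Defs.
From HB Require Import structures.
From mathcomp Require Import all_boot all_order all_algebra.
From mathcomp Require Import sesquilinear complex.
From mathcomp Require Import classical_sets reals.

Import Order.TTheory GRing.Theory Num.Theory.
Local Open Scope ring_scope.
Local Open Scope classical_set_scope.

(** The inverse of the unit, [B = U^-1], is a nondegenerate symmetric form on
row vectors, and [E = B X] is a [B]-selfadjoint idempotent, so the space splits
orthogonally into the range and the kernel of [E].  The relations of the algebra
say how [V] and [W] sit in this Peirce decomposition: [V] lives on the range of
[E] ([peirce_V]), while [W = C + C^T] with [C = W E] links the range to the kernel
([peirce_W]).

The products [V V], [V W], [W W] vanish, so the rows of [V] and [W] together span
a totally isotropic subspace.  For [n <= 5] its dimension is at most [2], which
leaves only one line [a] in the range and one line [d] in the kernel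
([peirce_rank]).  Hence [V] is a multiple of [a^T a] and [W = d^T a + a^T d]
([peirce_vectors]), with [a] and [d] isotropic.

Completing [a] and [d] to hyperbolic pairs inside the range and the kernel
([hyperbolic_frame_exists]) gives four vectors with a known Gram matrix.  For
[n = 4] they form a basis.  For [n = 5] their orthogonal complement is a line,
spanned by a unit vector [c]; it is stable under the selfadjoint idempotent [E],
so [c] lies in the range or in the kernel, and this dichotomy is what produces the
two normal forms ([hyperbolic_frame_completion]).  Finally a congruence by the
inverse transpose of the basis turns all of [U], [X], [V], [W] into the matrices
read off from the Gram matrix ([adapted_basis_congruent]). *)

(** * Nondegenerate symmetric forms *)

Section BilinearForms.
Variables (K : numClosedFieldType) (n : nat) (B : 'M[K]_n).
Hypotheses (B_sym : B^T = B) (B_unit : B \in unitmx).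

Lemma row_vector_right_inverse p (u : 'rV[K]_p) :
  u != 0 -> exists z : 'cV[K]_p, u *m z = 1%:M.
Proof.
by move=> u0; apply/row_freeP; rewrite /row_free rank_rV u0.
Qed.

(** The row space of [N] is contained in its own orthogonal, which has dimension
[n - \rank N]. *)
Lemma isotropic_rank m (N : 'M[K]_(m, n)) :
  N *m B *m N^T = 0 -> (2 * \rank N <= n)%N.
Proof.
move=> /mulmx0_rank_max; rewrite mxrank_tr mxrankMfree ?row_free_unit //.
by rewrite mul2n addnn.
Qed.

Lemma form_sym p q (u : 'M[K]_(p, n)) (v : 'M[K]_(q, n)) :
  (u *m B *m v^T)^T = v *m B *m u^T.
Proof. by rewrite !trmx_mul trmxK B_sym mulmxA. Qed.

(** Nondegeneracy gives a vector pairing to [1] with [u]; as [F] is selfadjoint,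
projecting it to the range of [F] does not change this pairing, and a multiple of
[u] can be subtracted to make it isotropic. *)
Lemma hyperbolic_partner (F : 'M[K]_n) (u : 'rV[K]_n) :
    F *m F = F -> F *m B = B *m F^T -> u *m F = u ->
    u != 0 -> u *m B *m u^T = 0 ->
  exists2 u' : 'rV[K]_n, u' *m F = u'
    & u *m B *m u'^T = 1%:M /\ u' *m B *m u'^T = 0.
Proof.
move=> FF FB uF u0 uu.
have uB0 : u *m B != 0.
  by apply: contra_neq u0 => uB0; rewrite -(mulmxK B_unit u) uB0 mul0mx.
have [z uBz] := row_vector_right_inverse _ _ uB0.
pose z' := z^T *m F.
have uz' : u *m B *m z'^T = 1%:M.
  by rewrite trmx_mul trmxK mulmxA -(mulmxA u) -FB mulmxA uF.
have z'u : z' *m B *m u^T = 1%:M by rewrite -form_sym uz' trmx1.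
pose s := (z' *m B *m z'^T) 0 0.
exists (z' - (2^-1 * s) *: u).
  by rewrite mulmxBl -scalemxAl uF -mulmxA FF.
rewrite linearB linearZ /= !mulmxBl !mulmxBr -!scalemxAl -!scalemxAr uu uz' z'u.
rewrite !scaler0 !subr0; split=> //.
rewrite [z' *m B *m z'^T]mx11_scalar -/s scalemx1 -!raddfB /=.
by rewrite -addrA -opprD -mulrDl -[2^-1]mul1r -splitr mul1r subrr raddf0.
Qed.

(** The orthogonal of a nondegenerate hyperplane is a line.  If it were isotropic
it would lie in its own orthogonal, that is, in the hyperplane, against the
invertibility of the Gram matrix of [N].  A square root in [K] then normalizes the
spanning vector. *)
Lemma orthonormal_completion m (N : 'M[K]_(m, n)) :
    n = m.+1 -> N *m B *m N^T \in unitmx ->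
  exists c : 'rV[K]_n, c *m B *m N^T = 0 /\ c *m B *m c^T = 1%:M.
Proof.
move=> nm GN.
have NBlt : (\rank (N *m B)^T < n)%N.
  by rewrite mxrank_tr (leq_ltn_trans (rank_leq_row _)) // nm.
have: kermx (N *m B)^T != 0.
  by rewrite kermx_eq0 /row_free neq_ltn NBlt.
rewrite -nz_row_eq0; set c0 := nz_row _ => c0_neq0.
have c0N : c0 *m B *m N^T = 0.
  rewrite -mulmxA -{1}B_sym -trmx_mul.
  by apply/sub_kermxP; apply: nz_row_sub.
have c0c0 : (c0 *m B *m c0^T) 0 0 != 0.
  apply: (contra_neq _ c0_neq0) => s0.
  have c0c0 : c0 *m B *m c0^T = 0.
    by rewrite [LHS]mx11_scalar s0 raddf0.
  have rN : \rank N = m.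
    apply/eqP; rewrite eqn_leq rank_leq_row -{1}(mxrank_unit GN) -mulmxA.
    exact: mxrankM_maxl.
  have rNc : (\rank (col_mx N c0) <= m)%N.
    have : c0 *m B *m (col_mx N c0)^T = 0.
      by rewrite tr_col_mx mul_mx_row c0N c0c0 row_mx0.
    move/mulmx0_rank_max; rewrite mxrankMfree ?row_free_unit // mxrank_tr.
    by rewrite rank_rV c0_neq0 add1n => /leq_trans/(_ (eq_leq nm)).
  have sub : (c0 <= N)%MS.
    have /andP[NS _] : (N <= col_mx N c0)%MS && (c0 <= col_mx N c0)%MS.
      by rewrite -col_mx_sub submx_refl.
    have : (col_mx N c0 <= N)%MS.
      by rewrite -(mxrank_leqif_sup NS) rN eqn_leq rNc -{1}rN mxrankS.
    by rewrite col_mx_sub => /andP[].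
  have [s c0E] := submxP sub.
  move: c0N; rewrite c0E -!mulmxA (mulmxA N) => sG.
  by rewrite -(mulmxK GN s) sG !mul0mx.
set s := (c0 *m B *m c0^T) 0 0 in c0c0.
have r0 : sqrtC s != 0 by rewrite sqrtC_eq0.
exists ((sqrtC s)^-1 *: c0); rewrite -!scalemxAl c0N scaler0; split=> //.
rewrite linearZ /= -scalemxAr scalerA [c0 *m B *m c0^T]mx11_scalar -/s.
rewrite -{3}[s]sqrtCK scale_scalar_mx expr2 mulrA mulrAC -(mulrA _^-1).
by rewrite mulVf // mulr1 mulVf.
Qed.
End BilinearForms.

(** * Peirce decomposition *)

Section PeirceDecomposition.
Variables (K : numClosedFieldType) (n : nat) (B X V W : 'M[K]_n).
Hypotheses (B_sym : B^T = B) (B_unit : B \in unitmx).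
Hypotheses (X_sym : X^T = X) (V_sym : V^T = V) (W_sym : W^T = W).
Hypothesis XX : X *m B *m X = X.
Hypothesis XV : X *m B *m V + V *m B *m X = V + V.
Hypothesis XW : X *m B *m W + W *m B *m X = W.
Hypothesis VV : V *m B *m V = 0.
Hypothesis VW : V *m B *m W + W *m B *m V = 0.
Hypothesis WW : W *m B *m W = 0.

Let E := B *m X.

Let trE : E^T = X *m B.
Proof. by rewrite trmx_mul B_sym X_sym. Qed.

Lemma peirce_idempotent : E *m E = E.
Proof. by rewrite /E -mulmxA (mulmxA X) XX. Qed.

Lemma peirce_selfadjoint : E *m B = B *m E^T.
Proof. by rewrite trE mulmxA. Qed.

Let EtEt : E^T *m E^T = E^T.
Proof. by rewrite -trmx_mul peirce_idempotent. Qed.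

(** Multiplying the relation [XV] by [E] on either side shows that both of its terms
are equal to [E^T V E]. *)
Lemma peirce_V : V *m E = V.
Proof.
have XV' : E^T *m V + V *m E = V + V by rewrite trE mulmxA.
have r : E^T *m V *m E = V *m E.
  have := congr1 (mulmxr E) XV'; rewrite /= !mulmxDl -(mulmxA V E).
  by rewrite peirce_idempotent => /addIr.
have l : E^T *m V *m E = E^T *m V.
  have := congr1 (mulmx E^T) XV'; rewrite /= !mulmxDr !mulmxA EtEt.
  by move=> /addrI.
move: XV'; rewrite -l r -!mulr2n => /eqP.
by rewrite -!scaler_nat (inj_eq (scalerI _)) ?pnatr_eq0 // => /eqP.
Qed.

Let C := W *m E.

Let CE : C *m E = C.
Proof. by rewrite /C -mulmxA peirce_idempotent. Qed.

Let trC : C^T = E^T *m W.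
Proof. by rewrite trmx_mul W_sym. Qed.

Lemma peirce_W : W = C + C^T.
Proof. by rewrite trC trE addrC /C /E mulmxA XW. Qed.

Let CtE : C^T *m E = 0.
Proof.
apply: (addrI C); rewrite addr0.
by rewrite -{1}CE -mulmxDl -peirce_W.
Qed.

Let EtC : E^T *m C = 0.
Proof. by apply: trmx_inj; rewrite trmx_mul trmxK CtE trmx0. Qed.

(** The form pairs the rows of [V], in the range of [E], only with the part [C] of
[W], and only the term [W B V] of the relation [VW] survives multiplication by
[E] on the right. *)
Lemma peirce_VBW : V *m B *m W = 0.
Proof.
have VBWE : V *m B *m W *m E = 0.
  rewrite -(mulmxA _ W) -/C -{1}peirce_V -(mulmxA V E B).
  by rewrite peirce_selfadjoint -!mulmxA EtC !mulmx0.
have WBV : W *m B *m V = 0.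
  have := congr1 (mulmxr E) VW.
  by rewrite /= mulmxDl VBWE add0r -mulmxA peirce_V mul0mx.
by move: VW; rewrite WBV addr0.
Qed.

(** The rows of [C^T] lie in the kernel of [E] and those of [V] and [C] in its
range, so the two row spaces are independent; both are contained in the totally
isotropic row space of [V] and [W], whose rank is at most [2] because [n <= 5].  As
[C^T] already takes rank at least [1], at most [1] is left for [V] and [C]. *)
Lemma peirce_rank : (n <= 5)%N -> C != 0 -> (\rank (V + C)%MS <= 1)%N.
Proof.
move=> n5 C0.
have rk2 : (\rank (col_mx V W) <= 2)%N.
  have iso : col_mx V W *m B *m (col_mx V W)^T = 0.
    rewrite tr_col_mx V_sym W_sym mul_col_mx mul_col_row VV peirce_VBW WW.
    have -> : W *m B *m V = 0.
      apply: trmx_inj; rewrite -{1}V_sym -{1}W_sym -(form_sym _ _ B) ?trmxK //.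
      by rewrite ?V_sym ?W_sym ?peirce_VBW trmx0.
    exact: block_mx0.
  rewrite -ltnS -(@ltn_pmul2l 2) //.
  exact: leq_trans (isotropic_rank _ _ _ B_unit _ _ iso) n5.
have sub : ((V + C) + C^T <= col_mx V W)%MS.
  have /andP[sV sW] : (V <= col_mx V W)%MS && (W <= col_mx V W)%MS.
    by rewrite -col_mx_sub submx_refl.
  have sCt : (C^T <= col_mx V W)%MS by rewrite trC (submx_trans (submxMl _ _)).
  have sC : (C <= col_mx V W)%MS.
    have -> : C = W - C^T by rewrite {1}peirce_W addrK.
    by rewrite addmx_sub // eqmx_opp.
  by rewrite !addsmx_sub sV sC sCt.
have dir : ((V + C) :&: C^T)%MS = 0.
  apply/eqP; rewrite -submx0; apply/rV_subP => u; rewrite sub_capmx submx0.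
  move=> /andP[/sub_addsmxP[[u1 u2]] /= uE /submxP[u3 uE']].
  have uEE : u *m E = u by rewrite uE mulmxDl -(mulmxA u1) -(mulmxA u2) peirce_V CE.
  by rewrite -uEE uE' -mulmxA CtE mulmx0.
have := leq_trans (mxrankS sub) rk2.
rewrite mxrank_disjoint_sum // mxrank_tr.
have : (0 < \rank C)%N by rewrite lt0n mxrank_eq0.
case: (\rank C) => // k _; rewrite addnS ltnS.
exact: leq_trans (leq_addr _ _).
Qed.

(** By [peirce_rank] the rows of [V] and of [C] are multiples of a single row [a],
so [C = d^T a] for some [d], and [V], being symmetric, is a multiple of [a^T a].
The row [a] is isotropic because [V B V = 0], and [d] because
[C^T B C = E^T (W B W) E = 0]. *)
Lemma peirce_vectors : (n <= 5)%N -> V != 0 -> W != 0 ->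
  exists a d : 'rV[K]_n, exists2 k : K, k != 0 &
    [/\ V = k *: (a^T *m a) /\ W = d^T *m a + a^T *m d,
        a != 0 /\ d != 0,
        a *m E = a /\ d *m E = 0
      & a *m B *m a^T = 0 /\ d *m B *m d^T = 0].
Proof.
move=> n5 V0 W0.
have C0 : C != 0.
  by apply: contra_neq W0 => C0; rewrite peirce_W C0 trmx0 addr0.
pose a := nz_row (V + C)%MS.
have aS : (a <= V + C)%MS by apply: nz_row_sub.
have a0 : a != 0.
  rewrite nz_row_eq0 -submx0 addsmx_sub !submx0.
  by rewrite negb_and V0.
have Sa : (V + C <= a)%MS.
  rewrite -(mxrank_leqif_sup aS) rank_rV a0 eqn_leq peirce_rank // andbT.
  by rewrite lt0n mxrank_eq0 -submx0 addsmx_sub !submx0 negb_and V0.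
have [b ab1] := row_vector_right_inverse _ _ _ a0.
move: Sa; rewrite addsmx_sub => /andP[/submxP[s Vs] /submxP[t Ct]].
pose d := t^T.
have Cd : C = d^T *m a by rewrite trmxK.
have d0 : d != 0.
  by apply: contra_neq C0 => d0; rewrite Cd d0 trmx0 mul0mx.
have [b' db1] := row_vector_right_inverse _ _ _ d0.
have db1' : b'^T *m d^T = 1%:M by rewrite -trmx_mul db1 trmx1.
have ab1' : b^T *m a^T = 1%:M by rewrite -trmx_mul ab1 trmx1.
pose k := (s^T *m b) 0 0.
have sk : s = k *: a^T.
  have := congr1 (mulmxr b) V_sym; rewrite /= {1}Vs trmx_mul -!mulmxA Vs -mulmxA.
  by rewrite ab1 mulmx1 => <-; rewrite [s^T *m b]mx11_scalar mul_mx_scalar.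
have VE : V = k *: (a^T *m a) by rewrite Vs sk scalemxAl.
have k0 : k != 0 by apply: contra_neq V0 => k0; rewrite VE k0 scale0r.
have WE : W = d^T *m a + a^T *m d.
  by rewrite peirce_W Cd trmx_mul trmxK.
exists a, d, k => //; split=> //.
- split.
  + by rewrite -[LHS]mul1mx -db1' -[RHS]mul1mx -db1' -!mulmxA (mulmxA _ a) -Cd CE.
  + rewrite -[LHS]mul1mx -ab1' -mulmxA (mulmxA a^T).
    have -> : a^T *m d = C^T by rewrite Cd trmx_mul trmxK.
    by rewrite CtE mulmx0.
- split.
  + have := VV; rewrite VE -!scalemxAl -!scalemxAr scalerA => /eqP.
    rewrite scaler_eq0 mulf_eq0 (negPf k0) /= => /eqP VV0.
    have := congr1 (fun M => b^T *m M *m b) VV0.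
    by rewrite /= !mulmxA ab1' mul1mx mulmx0 mul0mx -mulmxA ab1 mulmx1.
  + have CBC : C^T *m B *m C = 0.
      by rewrite trC /C -!mulmxA (mulmxA W) (mulmxA _ W) WW mul0mx mulmx0.
    move: CBC; rewrite Cd trmx_mul trmxK => CBC.
    have := congr1 (fun M => b^T *m M *m b) CBC.
    by rewrite /= !mulmxA ab1' mul1mx mulmx0 mul0mx -mulmxA ab1 mulmx1.
Qed.
End PeirceDecomposition.

(** * Congruence to an adapted basis *)

Section AdaptedBasis.
Variables (K : numClosedFieldType).

(** Two hyperbolic pairs and a unit vector, truncated to size [n]. *)
Definition hyperbolic_gram (n : nat) : 'M[K]_n := mx_of_rows n
  [:: [:: 0; 1; 0; 0; 0];
      [:: 1; 0; 0; 0; 0];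
      [:: 0; 0; 0; 1; 0];
      [:: 0; 0; 1; 0; 0];
      [:: 0; 0; 0; 0; 1]].

(** The size must not cut a hyperbolic pair in two, which excludes [1] and [3]. *)
Lemma hyperbolic_gram_involutive n :
  (n <= 5)%N -> n != 1%N -> n != 3%N ->
  hyperbolic_gram n *m hyperbolic_gram n = 1%:M.
Proof.
case: n => [|[|[|[|[|[|n]]]]]] // _ _ _; apply/matrixP;
  case=> [[|[|[|[|[|i]]]]] //= ?]; case=> [[|[|[|[|[|j]]]]] //= ?];
  rewrite !mxE !big_ord_recl big_ord0 !mxE /=;
  by rewrite ?(mulr0, mul0r, mulr1, addr0, add0r).
Qed.

Definition rows_mx m n (s : seq 'rV[K]_n) : 'M[K]_(m, n) := \matrix_(i < m) s`_i.

Lemma gram_rows_mx m n (B : 'M[K]_n) (s : seq 'rV[K]_n) (i j : 'I_m) :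
  (rows_mx m n s *m B *m (rows_mx m n s)^T) i j = (s`_i *m B *m (s`_j)^T) 0 0.
Proof.
have rowQ (k : 'I_m) : s`_k = row k (rows_mx m n s) by rewrite rowK.
rewrite !rowQ -row_mul !mxE; apply: eq_bigr => k _.
by rewrite !mxE.
Qed.

Lemma mul_tr_delta_mx n (Q : 'M[K]_n) (i j : 'I_n) :
  Q^T *m delta_mx i j *m Q = (row i Q)^T *m row j Q.
Proof.
by rewrite !rowE trmx_mul trmx_delta mulmxA -[in RHS](mulmxA Q^T) mul_delta_mx.
Qed.

(** If [J] is the Gram matrix of the basis [Q] and [J] is an involution, then
[U = Q^T J Q].  When moreover [Q] consists of eigenvectors of [U^-1 X], the same
holds of [X] and [U - X] with [J] weighted by the eigenvalues, so that [Q^-T]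
brings the whole space to its coordinate form at once. *)
Lemma adapted_basis_congruent n (U X V W J Q : 'M[K]_n) (l : 'rV[K]_n)
    (i0 i2 : 'I_n) (k : K) (L : set 'M[K]_n) :
    U \in unitmx -> J *m J = 1%:M -> Q *m invmx U *m Q^T = J ->
    Q *m (invmx U *m X) = diag_mx l *m Q -> k != 0 ->
    V = k *: ((row i0 Q)^T *m row i0 Q) ->
    W = (row i2 Q)^T *m row i0 Q + (row i0 Q)^T *m row i2 Q ->
    L = [set M | exists v w x y : K,
           M = v *: V + w *: W + x *: X + y *: (U - X)] ->
  congruent L [set M | exists v w x y : K,
    M = v *: delta_mx i0 i0 + w *: (delta_mx i2 i0 + delta_mx i0 i2)
        + J *m diag_mx (\row_j (x * l 0 j + y * (1 - l 0 j)))].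
Proof.
move=> Uu JJ QBQ QE k0 VE WE ->.
have Qu : Q \in unitmx.
  have [Ju _] := mulmx1_unit JJ; move: Ju; rewrite -QBQ !unitmx_mul.
  by case/andP=> /andP[].
have Qtu : Q^T \in unitmx by rewrite unitmx_tr.
have JQB : J *m Q *m invmx U = invmx Q^T.
  rewrite -[LHS](mulmxK Qtu) -(mulmxA J) -(mulmxA J) QBQ JJ.
  exact: mul1mx.
have UE : U = Q^T *m J *m Q.
  have : Q^T *m (J *m Q *m invmx U) *m U = U by rewrite JQB mulmxV // mul1mx.
  by rewrite !mulmxA mulmxKV.
have XE : X = Q^T *m (J *m diag_mx l) *m Q.
  by rewrite -[LHS](mulKVmx Uu) {1}UE -(mulmxA _ Q) QE !mulmxA.
have key v w x y : v *: V + w *: W + x *: X + y *: (U - X) =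
    Q^T *m ((v * k) *: delta_mx i0 i0 + w *: (delta_mx i2 i0 + delta_mx i0 i2)
      + J *m diag_mx (\row_j (x * l 0 j + y * (1 - l 0 j)))) *m Q.
  have -> : diag_mx (\row_j (x * l 0 j + y * (1 - l 0 j)))
      = x *: diag_mx l + y *: (1%:M - diag_mx l).
    apply/matrixP => i j; rewrite !mxE.
    by case: eqP => _; rewrite ?mulr0n ?mulr1n ?subrr ?mulr0 ?addr0.
  rewrite [J *m _]mulmxDr -!scalemxAr mulmxBr mulmx1.
  rewrite !mulmxDr !mulmxDl -!scalemxAr -!scalemxAl -!addrA; congr (_ + _).
    by rewrite mul_tr_delta_mx VE scalerA.
  congr (_ + _).
    by rewrite mulmxDr mulmxDl !mul_tr_delta_mx WE.
  by rewrite XE; congr (_ + _); rewrite mulmxBr mulmxBl -UE.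
exists (invmx Q^T); first by rewrite unitmx_inv.
have PQ N : invmx Q^T *m (Q^T *m N *m Q) *m (invmx Q^T)^T = N.
  by rewrite trmx_inv trmxK !mulmxA mulVmx // mul1mx mulmxK.
apply/seteqP; split=> M /=.
- move=> [v [w [x [y ->]]]].
  exists ((v / k) *: V + w *: W + x *: X + y *: (U - X)).
    by exists (v / k), w, x, y.
  by rewrite key PQ divfK.
- move=> [_ [v [w [x [y ->]]]] <-]; exists (v * k), w, x, y.
  by rewrite key PQ.
Qed.
End AdaptedBasis.

(** * The relations satisfied by an embedded copy of the algebra *)

Section Relations.
Variables (K : numClosedFieldType).

Lemma E2_coordE (i j : nat) : (i < 4)%N -> (j < 4)%N ->
  (inord i == inord j :> 'I_4) = (i == j).
Proof. by move=> li lj; rewrite -val_eqE /= !inordK. Qed.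

Lemma E2_products :
  [/\ E2_mul (E2_X K) (E2_X K) = E2_X K,
      E2_mul (E2_X K) (E2_V K) = E2_V K
    & E2_mul (E2_X K) (E2_W K) = 2^-1 *: E2_W K] /\
  [/\ E2_mul (E2_V K) (E2_V K) = 0,
      E2_mul (E2_V K) (E2_W K) = 0
    & E2_mul (E2_W K) (E2_W K) = 0].
Proof.
by split; split; rewrite E2_mulE; apply: E2_ext; rewrite !mxE !E2_coordE //=;
  rewrite ?(mulr0, mul0r, mulr1, mul1r, addr0, add0r).
Qed.

Lemma E2_basis (a : E2 K) :
  a = a 0 (inord 2) *: E2_V K + a 0 (inord 3) *: E2_W K
      + a 0 (inord 0) *: E2_X K + a 0 (inord 1) *: E2_Y K.
Proof.
by apply: E2_ext; rewrite !mxE !E2_coordE //=;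
  rewrite ?(mulr0, mulr1, addr0, add0r).
Qed.

(** An embedding is determined by the images of the basis vectors; that of [Y] is
[U - X], as the unit [X + Y] is sent to [U]. *)
Lemma E2_embedding_relations n (L : set 'M[K]_n) : is_embedding (E2 K) L ->
  exists U X V W : 'M[K]_n, let B := invmx U in
    [/\ U^T = U, U \in unitmx, X^T = X, V^T = V & W^T = W] /\
    [/\ X *m B *m X = X,
        X *m B *m V + V *m B *m X = V + V
      & X *m B *m W + W *m B *m X = W] /\
    [/\ V *m B *m V = 0,
        V *m B *m W + W *m B *m V = 0
      & W *m B *m W = 0] /\
    [/\ V != 0, W != 0
      & L = [set M | exists v w x y : K,
               M = v *: V + w *: W + x *: X + y *: (U - X)]].
Proof.
move=> [U [Usym Uu] [f [finj fsym fmul f1 LE]]].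
have symE (M : 'M[K]_n) : M \is symmetricmx -> M^T = M.
  by rewrite qualifE /= expr0 scale1r map_mx_id // => /eqP <-.
have two0 : 2 != 0 :> K by rewrite pnatr_eq0.
have prod a b c : jmul a b = c ->
    f a *m invmx U *m f b + f b *m invmx U *m f a = 2 *: f c.
  by move=> <-; rewrite fmul /sym_jmul scalerA divff // scale1r.
have half M N : M + M = 2 *: N -> M = N :> 'M[K]_n.
  rewrite -mulr2n -scaler_nat => /eqP.
  by rewrite (inj_eq (scalerI two0)) => /eqP.
have [[pXX pXV pXW] [pVV pVW pWW]] := E2_products.
exists U, (f (E2_X K)), (f (E2_V K)), (f (E2_W K)); split=> /=.
  by split=> //; apply: symE.
split.
  split.
  - exact/half/prod.
  - by rewrite (prod _ _ _ pXV) scaler_nat mulr2n.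
  - by rewrite (prod _ _ _ pXW) linearZ /= scalerA divff // scale1r.
split.
  split.
  - by apply: half; rewrite (prod _ _ _ pVV) linear0.
  - by rewrite (prod _ _ _ pVW) linear0 scaler0.
  - by apply: half; rewrite (prod _ _ _ pWW) linear0.
have fneq0 a : a != 0 -> f a != 0.
  by apply: contra_neq; rewrite -(linear0 f) => /finj.
have delta_neq0 k : delta_mx 0 k != 0 :> 'rV[K]_4.
  by apply/eqP => /matrixP/(_ 0 k)/eqP; rewrite !mxE !eqxx oner_eq0.
split; [exact/fneq0/delta_neq0 | exact/fneq0/delta_neq0 |].
have -> : U - f (E2_X K) = f (E2_Y K).
  by rewrite -f1 -linearB /jone /= /E2_one addrAC subrr add0r.
rewrite LE; apply/seteqP; split=> M /=.
- move=> [a _ <-]; exists (a 0 (inord 2)), (a 0 (inord 3)), (a 0 (inord 0)),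
    (a 0 (inord 1)).
  by rewrite {1}[a]E2_basis !linearD !linearZ.
- move=> [v [w [x [y ->]]]].
  exists (v *: E2_V K + w *: E2_W K + x *: E2_X K + y *: E2_Y K) => //.
  by rewrite !linearD !linearZ.
Qed.
End Relations.

(** * Hyperbolic frames *)

Section HyperbolicFrames.
Variables (K : numClosedFieldType) (n : nat) (B X : 'M[K]_n).
Hypotheses (B_sym : B^T = B) (B_unit : B \in unitmx) (X_sym : X^T = X).
Hypothesis XX : X *m B *m X = X.

(** One hyperbolic pair in the range and one in the kernel of [B X]; the two pairs
are then mutually orthogonal by [range_kernel_orthogonal]. *)
Record hyperbolic_frame (a a' d d' : 'rV[K]_n) : Prop := HyperbolicFrame {
  frame_range : a *m (B *m X) = a /\ a' *m (B *m X) = a';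
  frame_kernel : d *m (B *m X) = 0 /\ d' *m (B *m X) = 0;
  frame_a : [/\ a *m B *m a^T = 0, a *m B *m a'^T = 1%:M
              & a' *m B *m a'^T = 0];
  frame_d : [/\ d *m B *m d^T = 0, d *m B *m d'^T = 1%:M
              & d' *m B *m d'^T = 0]
}.

(** The partner of [a] is sought in the range of [B X], that of [d] in the range of
the complementary idempotent. *)
Lemma hyperbolic_frame_exists (a d : 'rV[K]_n) :
    a != 0 -> d != 0 -> a *m (B *m X) = a -> d *m (B *m X) = 0 ->
    a *m B *m a^T = 0 -> d *m B *m d^T = 0 ->
  exists a' d' : 'rV[K]_n, hyperbolic_frame a a' d d'.
Proof.
move=> a0 d0 aE dE aa dd.
have EE : B *m X *m (B *m X) = B *m X by apply: peirce_idempotent.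
have EB : B *m X *m B = B *m (B *m X)^T by apply: peirce_selfadjoint.
have [a' a'E [aa' a'a']] :=
  hyperbolic_partner _ _ _ B_sym B_unit _ _ EE EB aE a0 aa.
pose F := 1%:M - B *m X.
have FF : F *m F = F.
  by rewrite /F mulmxBl mul1mx mulmxBr mulmx1 EE subrr subr0.
have FB : F *m B = B *m F^T.
  by rewrite /F mulmxBl mul1mx EB linearB /= trmx1 mulmxBr mulmx1.
have dF : d *m F = d by rewrite mulmxBr mulmx1 dE subr0.
have [d' d'F [dd' d'd']] :=
  hyperbolic_partner _ _ _ B_sym B_unit _ _ FF FB dF d0 dd.
exists a', d'; split=> //; split=> //.
by rewrite -d'F -mulmxA mulmxBl mul1mx EE subrr mulmx0.
Qed.

(** A selfadjoint idempotent has orthogonal range and kernel. *)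
Lemma range_kernel_orthogonal (u v : 'rV[K]_n) :
  u *m (B *m X) = u -> v *m (B *m X) = 0 -> u *m B *m v^T = 0.
Proof.
move=> uE vE; rewrite -uE -(mulmxA u) peirce_selfadjoint //.
by rewrite -!mulmxA -trmx_mul vE trmx0 !mulmx0.
Qed.

Variables a a' d d' : 'rV[K]_n.
Hypothesis F : hyperbolic_frame a a' d d'.

Lemma hyperbolic_frame_gram :
  let Q := rows_mx K 4 n [:: a; a'; d; d'] in
  Q *m B *m Q^T = hyperbolic_gram K 4.
Proof.
case: F => [[aE a'E] [dE d'E] [aa aa' a'a'] [dd dd' d'd']] /=.
have sym (u v : 'rV[K]_n) : u *m B *m v^T = (v *m B *m u^T)^T.
  by rewrite form_sym.
have orth := range_kernel_orthogonal.
have a'a : a' *m B *m a^T = 1%:M by rewrite sym aa' trmx1.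
have d'd : d' *m B *m d^T = 1%:M by rewrite sym dd' trmx1.
have cross (u v : 'rV[K]_n) : u *m (B *m X) = u -> v *m (B *m X) = 0 ->
    (u *m B *m v^T = 0) * (v *m B *m u^T = 0).
  by move=> uE vE; rewrite [v *m _ *m _]sym orth // trmx0.
have ad := cross _ _ aE dE; have ad' := cross _ _ aE d'E.
have a'd := cross _ _ a'E dE; have a'd' := cross _ _ a'E d'E.
apply/matrixP => i j; rewrite gram_rows_mx.
by case: i => [[|[|[|[|i]]]] //= ?]; case: j => [[|[|[|[|j]]]] //= ?];
  rewrite ?(aa, aa', a'a', a'a, dd, dd', d'd', d'd, ad, ad', a'd, a'd') !mxE.
Qed.

Lemma hyperbolic_frame_eigen :
  let Q := rows_mx K 4 n [:: a; a'; d; d'] in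
  Q *m (B *m X) = diag_mx (\row_i [:: 1; 1; 0; 0]`_i) *m Q.
Proof.
case: F => [[aE a'E] [dE d'E] _ _] /=; apply/row_matrixP => i.
rewrite row_mul row_mul row_diag_mx -scalemxAl -rowE !rowK mxE.
by case: i => [[|[|[|[|i]]]] //= ?]; rewrite ?scale1r ?scale0r.
Qed.

End HyperbolicFrames.

(** The idempotent [B X] preserves the span of the frame and is selfadjoint, hence
it preserves the orthogonal line spanned by [c]; its eigenvalue there is [0] or
[1], which is recorded as the boolean [e]. *)
Lemma hyperbolic_frame_completion (K : numClosedFieldType) (B X : 'M[K]_5)
    (a a' d d' : 'rV[K]_5) :
    B^T = B -> B \in unitmx -> X^T = X -> X *m B *m X = X ->
    hyperbolic_frame K 5 B X a a' d d' ->
  exists (c : 'rV[K]_5) (e : bool),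
  let Q := rows_mx K 5 5 [:: a; a'; d; d'; c] in
  Q *m B *m Q^T = hyperbolic_gram K 5 /\
  Q *m (B *m X) = diag_mx (\row_i [:: 1; 1; 0; 0; e%:R]`_i) *m Q.
Proof.
move=> B_sym B_unit X_sym XX F.
have G := hyperbolic_frame_gram _ _ _ _ B_sym X_sym _ _ _ _ F.
have NE := hyperbolic_frame_eigen _ _ _ _ _ _ _ _ F.
move: G NE => /=; set N := rows_mx _ _ _ _ => G NE.
have JJ := hyperbolic_gram_involutive K 4 isT isT isT.
have Gu : N *m B *m N^T \in unitmx by rewrite G; case: (mulmx1_unit JJ).
have [c [cN cc]] := orthonormal_completion _ _ _ B_sym B_unit _ N erefl Gu.
have EB := peirce_selfadjoint _ _ _ _ B_sym X_sym.
have EE := peirce_idempotent _ _ _ _ XX.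
have cs (i : 'I_4) : c *m B *m ([:: a; a'; d; d']`_i)^T = 0.
  by rewrite -(rowK (fun i : 'I_4 => [:: a; a'; d; d']`_i) i) rowE trmx_mul
    mulmxA cN mul0mx.
have cs' (u : 'rV[K]_5) : c *m B *m u^T = 0 -> u *m B *m c^T = 0.
  by move=> cu; rewrite -form_sym // cu trmx0.
pose Q := rows_mx K 5 5 [:: a; a'; d; d'; c].
(* Entries off the last row and column are those of the frame. *)
have GQ : Q *m B *m Q^T = hyperbolic_gram K 5.
  apply/matrixP => i j; rewrite gram_rows_mx.
  have ca := cs (@Ordinal 4 0 isT); have ca' := cs (@Ordinal 4 1 isT).
  have cd := cs (@Ordinal 4 2 isT); have cd' := cs (@Ordinal 4 3 isT).
  have ac := cs' _ ca; have a'c := cs' _ ca'.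
  have dc := cs' _ cd; have d'c := cs' _ cd'.
  rewrite /= in ca ca' cd cd' ac a'c dc d'c.
  have G4 (i' j' : 'I_4) := congr1 (fun M : 'M_4 => M i' j') G.
  case: (ltnP i 4) => i4; last first.
    have -> : i = ord_max by apply/val_inj/anti_leq; rewrite -ltnS ltn_ord.
    by case: j => [[|[|[|[|[|j]]]]] //= ?]; rewrite ?(ca, ca', cd, cd', cc) !mxE.
  case: (ltnP j 4) => j4; last first.
    have -> : j = ord_max by apply/val_inj/anti_leq; rewrite -ltnS ltn_ord.
    by case: i i4 => [[|[|[|[|[|i]]]]] //= ?] _; rewrite ?(ac, a'c, dc, d'c) !mxE.
  have := G4 (Ordinal i4) (Ordinal j4); rewrite gram_rows_mx.
  by case: i i4 => [[|[|[|[|[|i]]]]] //= ?] i4;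
    case: j j4 => [[|[|[|[|[|j]]]]] //= ?] j4 ->; rewrite !mxE.
have BQu : B *m Q^T \in unitmx.
  have JJ5 := hyperbolic_gram_involutive K 5 isT isT isT.
  have : Q *m (B *m Q^T) \in unitmx.
    by rewrite mulmxA GQ; case: (mulmx1_unit JJ5).
  by rewrite unitmx_mul => /andP[].
have [l cE] : exists l : K, c *m (B *m X) = l *: c.
  (* The value [l] makes [c B X - l c] orthogonal to [c]; it is orthogonal to the
     frame anyway, hence zero. *)
  pose l := (c *m (B *m X) *m B *m c^T) 0 0; exists l.
  apply/eqP; rewrite -subr_eq0; set w := _ - _.
  suff wQ : w *m B *m Q^T = 0.
    by apply/eqP; rewrite -(mulmxK BQu w) mulmxA wQ mul0mx.
  apply: trmx_inj; rewrite form_sym // trmx0; apply/row_matrixP => j.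
  rewrite row0 !row_mul -form_sym // rowK.
  have wu (u : 'rV[K]_5) (m : K) :
      c *m B *m u^T = 0 -> u *m (B *m X) = m *: u -> w *m B *m u^T = 0.
    move=> cu uE; rewrite !mulmxBl -!scalemxAl cu scaler0 subr0.
    rewrite -(mulmxA c) EB -(mulmxA c) -(mulmxA B) -trmx_mul uE linearZ /=.
    by rewrite -!scalemxAr mulmxA cu scaler0.
  suff -> : w *m B *m ([:: a; a'; d; d'; c]`_j)^T = 0 by rewrite trmx0.
  case: (ltnP j 4) => j4; last first.
    have -> : j = ord_max by apply/val_inj/anti_leq; rewrite -ltnS ltn_ord.
    rewrite /= !mulmxBl -!scalemxAl cc scalemx1.
    by rewrite [X in X - _]mx11_scalar subrr.
  have eig := congr1 (row (Ordinal j4)) NE.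
  rewrite !row_mul row_diag_mx -scalemxAl -rowE !rowK in eig.
  have := wu _ _ (cs (Ordinal j4)) eig.
  by case: j j4 {eig} => [[|[|[|[|[|j]]]]] ? ?].
have c0 : c != 0.
  apply/eqP => c0; move: cc; rewrite c0 !mul0mx => /matrixP/(_ 0 0)/eqP.
  by rewrite !mxE eq_sym oner_eq0.
have ll : l * l = l.
  apply/eqP; rewrite -subr_eq0; have := congr1 (mulmx c) EE.
  rewrite mulmxA cE -scalemxAl cE scalerA => /eqP.
  by rewrite -subr_eq0 -scalerBl scaler_eq0 (negPf c0) orbF.
have [e le] : exists e : bool, l = e%:R.
  move/eqP: ll; rewrite -subr_eq0 -{3}[l]mulr1 -mulrBr mulf_eq0 subr_eq0.
  by case/orP=> /eqP ->; [exists false | exists true].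
exists c, e; split=> //.
apply/row_matrixP => j; rewrite !row_mul row_diag_mx -scalemxAl -rowE !rowK mxE.
case: F => [[aE a'E] [dE d'E] _ _].
by case: j => [[|[|[|[|[|j]]]]] //= ?];
  rewrite ?scale1r ?scale0r // cE le.
Qed.

(** * Normal forms of the embeddings *)

Section Classification.
Variable K : numClosedFieldType.

Lemma E2_embedding_frame n (L : set 'M[K]_n) : (n <= 5)%N ->
    is_embedding (E2 K) L ->
  exists U X V W : 'M[K]_n, exists a a' d d' : 'rV[K]_n, exists2 k : K, k != 0 &
    [/\ U^T = U, U \in unitmx, X^T = X & X *m invmx U *m X = X] /\
    [/\ hyperbolic_frame K n (invmx U) X a a' d d',
        V = k *: (a^T *m a), W = d^T *m a + a^T *m d
      & L = [set M | exists v w x y : K,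
               M = v *: V + w *: W + x *: X + y *: (U - X)]].
Proof.
move=> n5 /E2_embedding_relations[U [X [V [W /= ]]]].
move=> [[Us Uu Xs Vs Ws] [[XX XV XW] [[VV VW WW] [V0 W0 LE]]]].
have Bs : (invmx U)^T = invmx U by rewrite trmx_inv Us.
have Bu : invmx U \in unitmx by rewrite unitmx_inv.
have [a [d [k k0 [[VE WE] [a0 d0] [aE dE] [aa dd]]]]] :=
  peirce_vectors _ _ _ _ _ _ Bs Bu Xs Vs Ws XX XV XW VV VW WW n5 V0 W0.
have [a' [d' F]] :=
  hyperbolic_frame_exists _ _ _ _ Bs Bu Xs XX _ _ a0 d0 aE dE aa dd.
by exists U, X, V, W, a, a', d, d'; exists k.
Qed.

Lemma set_of_mx_ext n (F G : K -> K -> K -> K -> 'M[K]_n) :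
  (forall v w x y, F v w x y = G v w x y) ->
  [set M | exists v w x y, M = F v w x y] =
  [set M | exists v w x y, M = G v w x y].
Proof.
move=> FG; apply/seteqP; split=> M [v [w [x [y ->]]]];
  by exists v, w, x, y; rewrite FG.
Qed.

Lemma E2_embedding_4 (L : set 'M[K]_4) : is_embedding (E2 K) L ->
  congruent L
    [set M | exists v w x y : K, M = mx_of_rows 4
       [:: [:: v; x; w; 0];
           [:: x; 0; 0; 0];
           [:: w; 0; 0; y];
           [:: 0; 0; y; 0]]].
Proof.
move=> /E2_embedding_frame -/(_ isT) [U [X [V [W [a [a' [d [d' [k k0]]]]]]]]].
move=> [[Us Uu Xs XX] [F VE WE LE]].
have Bs : (invmx U)^T = invmx U by rewrite trmx_inv Us.
have G := hyperbolic_frame_gram _ _ _ _ Bs Xs _ _ _ _ F.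
have QE := hyperbolic_frame_eigen _ _ _ _ _ _ _ _ F.
have JJ := hyperbolic_gram_involutive K 4 isT isT isT.
have := adapted_basis_congruent _ _ _ _ _ _ _ _ _
  (@Ordinal 4 0 isT) (@Ordinal 4 2 isT) _ _ Uu JJ G QE k0.
rewrite !rowK /= => /(_ _ _ _ VE WE LE).
congr congruent; apply: set_of_mx_ext => v w x y.
rewrite mul_mx_diag; apply/matrixP => i j; rewrite !mxE.
by case: i => [[|[|[|[|i]]]] //= ?]; case: j => [[|[|[|[|j]]]] //= ?];
  rewrite ?(mulr0, mul0r, mulr1, mul1r, addr0, add0r, subr0, subrr).
Qed.

(** The boolean tells whether the fifth basis vector lies in the range or in the
kernel of the idempotent attached to [X]. *)
Lemma E2_embedding_5 (L : set 'M[K]_5) : is_embedding (E2 K) L ->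
  exists e : bool, congruent L
    [set M | exists v w x y : K, M = mx_of_rows 5
       [:: [:: v; x; w; 0; 0];
           [:: x; 0; 0; 0; 0];
           [:: w; 0; 0; y; 0];
           [:: 0; 0; y; 0; 0];
           [:: 0; 0; 0; 0; if e then x else y]]].
Proof.
move=> /E2_embedding_frame -/(_ isT) [U [X [V [W [a [a' [d [d' [k k0]]]]]]]]].
move=> [[Us Uu Xs XX] [F VE WE LE]].
have Bs : (invmx U)^T = invmx U by rewrite trmx_inv Us.
have Bu : invmx U \in unitmx by rewrite unitmx_inv.
have [c [e [G QE]]] := hyperbolic_frame_completion _ _ _ _ _ _ _ Bs Bu Xs XX F.
have JJ := hyperbolic_gram_involutive K 5 isT isT isT.
exists e; have := adapted_basis_congruent _ _ _ _ _ _ _ _ _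
  (@Ordinal 5 0 isT) (@Ordinal 5 2 isT) _ _ Uu JJ G QE k0.
rewrite !rowK /= => /(_ _ _ _ VE WE LE).
congr congruent; apply: set_of_mx_ext => v w x y.
rewrite mul_mx_diag; apply/matrixP => i j; rewrite !mxE.
case: e {QE} => /=;
by case: i => [[|[|[|[|[|i]]]]] //= ?]; case: j => [[|[|[|[|[|j]]]]] //= ?];
  rewrite ?(mulr0, mul0r, mulr1, mul1r, addr0, add0r, subr0, subrr).
Qed.
End Classification.

Theorem propositionA25 (R : realType) :
  (forall L : set 'M[R[i]]_4, is_embedding (E2 R[i]) L ->
    congruent L
      [set M | exists v w x y : R[i], M = mx_of_rows 4
         [:: [:: v; x; w; 0];
             [:: x; 0; 0; 0];
             [:: w; 0; 0; y];
             [:: 0; 0; y; 0]]])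
  /\
  (forall L : set 'M[R[i]]_5, is_embedding (E2 R[i]) L ->
    congruent L
      [set M | exists v w x y : R[i], M = mx_of_rows 5
         [:: [:: v; x; w; 0; 0];
             [:: x; 0; 0; 0; 0];
             [:: w; 0; 0; y; 0];
             [:: 0; 0; y; 0; 0];
             [:: 0; 0; 0; 0; x]]]
    \/
    congruent L
      [set M | exists v w x y : R[i], M = mx_of_rows 5
         [:: [:: v; x; w; 0; 0];
             [:: x; 0; 0; 0; 0];
             [:: w; 0; 0; y; 0];
             [:: 0; 0; y; 0; 0];
             [:: 0; 0; 0; 0; y]]]).
Proof.
split=> L; first exact: E2_embedding_4.
by move=> /E2_embedding_5[[] Le]; [left | right].
Qed.
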